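(* Let $\mathcal{H}_1$ and $\mathcal{H}_2$ be two reproducing kernel Hilbert spaces on a set $E$ with the same reproducing kernel. Then $\mathcal{H}_1$ and $\mathcal{H}_2$ are equal (they consist of the same functions on $E$, with the same norm).
   Context: A reproducing kernel Hilbert space on a set $E$ is a Hilbert space $\mathcal{H}$ of functions $E\to\mathbb{C}$ (with pointwise operations) for which every evaluation $\varphi\mapsto\varphi(z)$, $z\in E$, is bounded; its reproducing kernel is $K(z,w)=k_w(z)$, where $k_w\in\mathcal{H}$ is the element with $\varphi(w)=\langle\varphi,k_w\rangle$ for all $\varphi\in\mathcal{H}$. *)

(* Defs.v *)
From HB Require Import structures.
From mathcomp Require Import all_boot all_order all_algebra.
From mathcomp Require Import sesquilinear.
From mathcomp Require Import complex.
From mathcomp Require Import boolp classical_sets functions reals.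
From mathcomp Require Import topology normedtype.

Set Implicit Arguments.
Unset Strict Implicit.
Unset Printing Implicit Defensive.

Import Order.TTheory GRing.Theory Num.Theory.
Import numFieldNormedType.Exports.
Local Open Scope classical_set_scope.
Local Open Scope ring_scope.
Local Open Scope complex_scope.

(* Complete normed modules whose underlying module is a submodule of [L]: the
   inclusion [val] into [L] is linear, and its range is the predicate [S].
   The norm is independent of any norm on [L]. *)
#[short(type="completeNormedSubModType")]
HB.structure Definition CompleteNormedSubModule
    (K : numFieldType) (L : lmodType K) (S : pred L) :=
  {V of @GRing.SubLmodule K L S V & CompleteNormedModule K V}.

(* [{dot V for Num.conj}] is the type of positive definite hermitian forms on
   [V], linear on the left and conjugate-linear on the right. *)
Record rkhs (R : realType) (E : Type) := RKHS {
  rkhs_set : set (E -> R[i]);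
  rkhs_sort :> completeNormedSubModType (mem rkhs_set);
  rkhs_dot : {dot rkhs_sort for Num.conj};
  rkhs_norm_dot : forall phi : rkhs_sort, `|phi| ^+ 2 = rkhs_dot phi phi;
  rkhs_eval_bounded : forall z : E, exists M : R,
    forall phi : rkhs_sort, `|val phi z| <= M%:C * `|phi| }.

Definition reproducing_kernel (R : realType) (E : Type) (H : rkhs R E)
    (K : E -> E -> R[i]) : Prop :=
  forall w : E, exists2 k_w : H,
    (forall phi : H, val phi w = rkhs_dot H phi k_w) &
    (forall z : E, K z w = val k_w z).

(* Main.v *)
(* Norms and values of finite combinations of kernel functions depend only on
   the kernel. Given phi in H1, let s_n be such combinations that minimize
   |phi - s_n| up to an error tending to 0. Comparing with s_n + a k_w shows
   that <phi - s_n, k_w> -> 0, i.e. s_n -> phi pointwise; comparing with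
   midpoints shows, by the parallelogram law, that (s_n) is Cauchy. The same
   combinations t_n in H2 are then Cauchy as well, so by completeness s_n and
   t_n converge in norm, hence pointwise, in H1 and H2: both limits are phi as
   functions, and |phi| = lim |s_n| = lim |t_n|. *)
Require Import Defs.
From mathcomp Require Import all_boot all_order all_algebra.
From mathcomp Require Import complex.
From mathcomp Require Import classical_sets reals.
From mathcomp Require Import sesquilinear boolp functions interval_inference.
From mathcomp Require Import topology normedtype sequences.
From mathcomp Require Import ring.

Set Implicit Arguments.
Unset Strict Implicit.
Unset Printing Implicit Defensive.

Import Order.TTheory GRing.Theory Num.Theory.
Import numFieldNormedType.Exports.
Local Open Scope classical_set_scope.
Local Open Scope ring_scope.
Local Open Scope complex_scope.

(** * Limits of sequences, in norm and pointwise *)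

Lemma natSinv_small (R : realType) (M e : R[i]) : 0 <= M -> 0 < e ->
  \forall n \near \oo, M * n.+1%:R^-1 < e.
Proof.
move=> M0 e0.
have M1 : 0 < M + 1 by rewrite ltr_wpDl.
have f0 : 0 < e / (M + 1) by rewrite divr_gt0.
have fE : (complex.Re (e / (M + 1)))%:C = e / (M + 1) by rewrite RRe_real // gtr0_real.
have r0 : 0 < complex.Re (e / (M + 1)) by rewrite -ltcR fE.
have := near_infty_natSinv_lt (PosNum r0); apply: filterS => n /=.
rewrite -ltcR fE fmorphV rmorph_nat ltr_pdivlMr // mulrC.
apply: le_lt_trans; apply: ler_wpM2r; first by rewrite invr_ge0.
by rewrite lerDl.
Qed.

Lemma sqr_bound_cvg0 (R : realType) (V : normedModType R[i]) (u : nat -> V) (M : R[i]) :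
  0 <= M -> (forall n, `|u n| ^+ 2 <= M * n.+1%:R^-1) -> u n @[n --> \oo] --> (0 : V).
Proof.
move=> M0 uM; apply/cvgr0Pnorm_lt => e e0.
have e2 : 0 < e ^+ 2 by rewrite exprn_gt0.
have := natSinv_small M0 e2; apply: filterS => n /(le_lt_trans (uM n)).
by rewrite ltr_pXn2r ?nnegrE ?(ltW e0).
Qed.

Lemma complex_cvg_unique (R : realType) (u : nat -> R[i]^o) (a b : R[i]^o) :
  u n @[n --> \oo] --> a -> u n @[n --> \oo] --> b -> a = b.
Proof. by apply: cvg_unique; exact: norm_hausdorff. Qed.

Lemma rkhs_cvg_eval (R : realType) (E : Type) (H : rkhs R E) (u : nat -> H) (l : H) (z : E) :
  u n @[n --> \oo] --> l -> (val (u n) z : R[i]^o) @[n --> \oo] --> (val l z : R[i]^o).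
Proof.
have [M hM] := rkhs_eval_bounded H z.
move=> /cvgrPdist_lt ul; apply/cvgrPdist_lt => e e0.
(* The bound [M] carries no sign; [|M| + 1] is a positive bound to divide by. *)
have M1 : 0 < `|M|%:C + 1 :> R[i] by rewrite ltr_wpDl // ler0c.
have := ul _ (divr_gt0 e0 M1); apply: filterS => n.
rewrite ltr_pdivlMr // mulrC; apply: le_lt_trans.
have -> : val l z - val (u n) z = val (l - u n) z by rewrite raddfB.
apply: le_trans (hM _) _; apply: ler_wpM2r => //.
rewrite -(rmorph1 (real_complex R)) -rmorphD lecR.
by rewrite (le_trans (ler_norm M)) // lerDl.
Qed.

(** * Finite combinations of kernel functions *)

(** The list [c] does not mention [H], so one list names a combination in each space. Points may
    repeat, so that addition is concatenation. *)
Definition kernel_comb (R : realType) (E : Type) (H : rkhs R E) (k : E -> H)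
    (c : seq (R[i] * E)) : H :=
  \sum_(p <- c) p.1 *: k p.2.

Definition repr_family (R : realType) (E : Type) (H : rkhs R E)
    (K : E -> E -> R[i]) (k : E -> H) : Prop :=
  (forall w (phi : H), val phi w = rkhs_dot H phi (k w)) /\
  (forall w z, val (k w) z = K z w).

Lemma reproducing_kernel_family (R : realType) (E : Type) (H : rkhs R E)
    (K : E -> E -> R[i]) :
  reproducing_kernel H K -> exists k : E -> H, repr_family K k.
Proof.
move=> hK; have /choice[k hk] : forall w, exists kw : H,
    (forall phi : H, val phi w = rkhs_dot H phi kw) /\ (forall z, K z w = val kw z).
  by move=> w; have [kw] := hK w; exists kw.
by exists k; split=> [w phi|w z]; have [h1 h2] := hk w.
Qed.

Lemma val_kernel_comb (R : realType) (E : Type) (H : rkhs R E)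
    (K : E -> E -> R[i]) (k : E -> H) (c : seq (R[i] * E)) (z : E) :
  repr_family K k -> val (kernel_comb k c) z = \sum_(p <- c) p.1 * K z p.2.
Proof.
move=> [_ hk]; rewrite /kernel_comb raddf_sum fct_sumE.
by apply: eq_bigr => p _; rewrite /= GRing.valZ -hk.
Qed.

(** Pairing with [k p.2] is evaluation at [p.2], which turns the Gram sum into values of [K], with
    no trace of [H]. *)
Lemma sqr_norm_kernel_comb (R : realType) (E : Type) (H : rkhs R E)
    (K : E -> E -> R[i]) (k : E -> H) (c : seq (R[i] * E)) :
  repr_family K k ->
  `|kernel_comb k c| ^+ 2 =
    \sum_(p <- c) Num.conj p.1 * \sum_(q <- c) q.1 * K p.2 q.2.
Proof.
move=> hk; rewrite rkhs_norm_dot {2}/kernel_comb linear_sumr.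
apply: eq_bigr => p _; rewrite linearZr_LR /= -hk.1.
by rewrite (val_kernel_comb _ _ hk).
Qed.

Lemma norm_kernel_comb (R : realType) (E : Type) (H1 H2 : rkhs R E)
    (K : E -> E -> R[i]) (k1 : E -> H1) (k2 : E -> H2) (c : seq (R[i] * E)) :
  repr_family K k1 -> repr_family K k2 ->
  `|kernel_comb k1 c| = `|kernel_comb k2 c|.
Proof.
move=> hk1 hk2; apply/eqP; rewrite -(@eqrXn2 _ 2) //.
by rewrite (sqr_norm_kernel_comb (K := K)) // (sqr_norm_kernel_comb (K := K)).
Qed.

Lemma kernel_comb_cat (R : realType) (E : Type) (H : rkhs R E) (k : E -> H) c d :
  kernel_comb k (c ++ d) = kernel_comb k c + kernel_comb k d.
Proof. by rewrite /kernel_comb big_cat. Qed.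

Lemma kernel_comb_scale (R : realType) (E : Type) (H : rkhs R E) (k : E -> H) a c :
  kernel_comb k [seq (a * p.1, p.2) | p <- c] = a *: kernel_comb k c.
Proof.
rewrite /kernel_comb big_map scaler_sumr; apply: eq_bigr => p _ /=.
by rewrite scalerA.
Qed.

Lemma kernel_comb_sub (R : realType) (E : Type) (H : rkhs R E) (k : E -> H) c d :
  kernel_comb k c - kernel_comb k d =
    kernel_comb k (c ++ [seq (-1 * p.1, p.2) | p <- d]).
Proof. by rewrite kernel_comb_cat kernel_comb_scale scaleN1r. Qed.

(** * Minimizing sequences of combinations *)

Definition minimizing (R : realType) (E : Type) (H : rkhs R E) (k : E -> H)
    (phi : H) (c : nat -> seq (R[i] * E)) : Prop :=
  forall n d, `|phi - kernel_comb k (c n)| ^+ 2 <=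
              `|phi - kernel_comb k d| ^+ 2 + n.+1%:R^-1.

Lemma minimizing_exists (R : realType) (E : Type) (H : rkhs R E) (k : E -> H)
    (phi : H) : exists c, minimizing k phi c.
Proof.
(* Norms lie in [R[i]], so the infimum is taken over their real parts, in [R]. *)
pose N d : R := complex.Re (`|phi - kernel_comb k d| ^+ 2).
have NE d : (N d)%:C = `|phi - kernel_comb k d| ^+ 2.
  by rewrite RRe_real // ger0_real // exprn_ge0.
have N0 d : 0 <= N d by rewrite -lecR NE exprn_ge0.
have lbN : has_lbound (range N) by exists 0 => _ [d _ <-].
have infN : has_inf (range N) by split; first by exists (N [::]), [::].
have /choice[c hc] : forall n, exists c, N c < inf (range N) + n.+1%:R^-1.
  move=> n; have n0 : 0 < n.+1%:R^-1 :> R by rewrite invr_gt0.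
  by have [_ [c _ <-]] := inf_adherent n0 infN; exists c.
exists c => n d; rewrite -!NE -(rmorph_nat (real_complex R)) -fmorphV -rmorphD lecR.
apply: (le_trans (ltW (hc n))); rewrite lerD2r.
by apply: ge_inf => //; exists d.
Qed.

(** For [e = 0] this is orthogonality of a minimizer. With [v] the dot product and [a = v / M],
    passing from [x] to [x - a *: g] lowers the squared norm by [|v|^2 / M + |v|^2 / M^2], which is
    therefore at most [e]. *)
Lemma near_orthogonal (R : realType) (E : Type) (H : rkhs R E) (x g : H) (e : R[i]) :
  (forall a, `|x| ^+ 2 <= `|x - a *: g| ^+ 2 + e) ->
  `|rkhs_dot H x g| ^+ 2 <= (`|g| ^+ 2 + 1) * e.
Proof.
set v := rkhs_dot H x g; set M := `|g| ^+ 2 + 1 => hx.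
have M0 : 0 < M by rewrite ltr_wpDl // exprn_ge0.
(* [a := v / |g|^2] would be optimal; the [+ 1] in [M] avoids the case [g = 0]. *)
have := hx (M^-1 * v).
rewrite !rkhs_norm_dot dnormB !linearZr_LR linearZl_LR /= -!rkhs_norm_dot -/v.
have -> : (M^-1 * v)^* * v = M^-1 * `|v| ^+ 2.
  by rewrite rmorphM /= geC0_conj ?invr_ge0 ?ltW // normCK mulrAC mulrA.
have -> : (M^-1 * v)^* * (M^-1 * v * `|g| ^+ 2) = M^-1 ^+ 2 * `|v| ^+ 2 * (M - 1).
  by rewrite rmorphM /= geC0_conj ?invr_ge0 ?ltW // normCK /M addrK; ring.
rewrite geC0_conj ?mulr_ge0 ?invr_ge0 ?exprn_ge0 ?(ltW M0) //.
move: (`|v| ^+ 2) (exprn_ge0 2 (normr_ge0 v)) => V V0.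
have -> : M^-1 ^+ 2 * V * (M - 1) = M^-1 * V - M^-1 ^+ 2 * V.
  by field; rewrite gt_eqF.
move=> hV; rewrite -ler_pdivrMl // -subr_ge0.
move: hV; rewrite -subr_ge0 => hV.
(* Discards the surplus [|v|^2 / M^2]. *)
have := addr_ge0 hV (mulr_ge0 (exprn_ge0 2 (ltW (_ : 0 < M^-1))) V0).
rewrite invr_gt0 => /(_ M0); congr (0 <= _); ring.
Qed.

(** Written with the midpoint, whose norm minimality bounds from below. *)
Lemma parallelogram (R : realType) (E : Type) (H : rkhs R E) (x y : H) :
  `|y - x| ^+ 2 = 2 * `|x| ^+ 2 + 2 * `|y| ^+ 2 - 4 * `|2^-1 *: (x + y)| ^+ 2.
Proof.
rewrite !rkhs_norm_dot dnormB linearZr_LR linearZl_LR /= dnormD.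
have -> : rkhs_dot H y x = (rkhs_dot H x y)^* by rewrite hermC expr0 mul1r.
rewrite conjCK geC0_conj ?invr_ge0 //.
by field.
Qed.

Lemma minimizing_cvg (R : realType) (E : Type) (H : rkhs R E)
    (K : E -> E -> R[i]) (k : E -> H) (phi : H) (c : nat -> seq (R[i] * E)) (w : E) :
  repr_family K k -> minimizing k phi c ->
  (val (kernel_comb k (c n)) w : R[i]^o) @[n --> \oo] --> (val phi w : R[i]^o).
Proof.
move=> hk hc; pose v n : R[i]^o := val (phi - kernel_comb k (c n)) w.
have vM n : `|v n| ^+ 2 <= (`|k w| ^+ 2 + 1) * n.+1%:R^-1.
  have hx (a : R[i]) : `|phi - kernel_comb k (c n)| ^+ 2 <=
      `|phi - kernel_comb k (c n) - a *: k w| ^+ 2 + n.+1%:R^-1.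
    (* Appending [(a, w)] to the list adds [a *: k w] to the combination. *)
    have := hc n (c n ++ [:: (a, w)]).
    by rewrite kernel_comb_cat [kernel_comb k [:: _]]big_seq1 /= opprD addrA.
  by rewrite /v hk.1; exact: near_orthogonal hx.
have v0 : v n @[n --> \oo] --> (0 : R[i]^o).
  by apply: sqr_bound_cvg0 vM; exact: addr_ge0 (exprn_ge0 2 (normr_ge0 _)) ler01.
rewrite -[val phi w]subr0.
have -> : (fun n => val (kernel_comb k (c n)) w : R[i]^o) = fun n => val phi w - v n.
  by apply: funext => n; rewrite /v raddfB /= opprB addrC subrK.
exact: cvgB (cvg_cst _) v0.
Qed.

Lemma minimizing_cauchy (R : realType) (E : Type) (H : rkhs R E)
    (k : E -> H) (phi : H) (c : nat -> seq (R[i] * E)) (m n : nat) :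
  minimizing k phi c ->
  `|kernel_comb k (c m) - kernel_comb k (c n)| ^+ 2 <= 2 * m.+1%:R^-1 + 2 * n.+1%:R^-1.
Proof.
move=> hc.
set x := phi - kernel_comb k (c m); set y := phi - kernel_comb k (c n).
have mid : phi - kernel_comb k [seq (2^-1 * p.1, p.2) | p <- c m ++ c n] = 2^-1 *: (x + y).
  rewrite kernel_comb_scale kernel_comb_cat /x /y addrACA -opprD scalerBr.
  rewrite [2^-1 *: (phi + phi)]scalerDr -scalerDl.
  have -> : 2^-1 + 2^-1 = 1 :> R[i] by field.
  by rewrite scale1r.
have := hc m [seq (2^-1 * p.1, p.2) | p <- c m ++ c n].
have := hc n [seq (2^-1 * p.1, p.2) | p <- c m ++ c n].
rewrite mid -/x -/y.
have -> : kernel_comb k (c m) - kernel_comb k (c n) = y - x.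
  by rewrite /x /y opprB [RHS]addrC subrKA.
rewrite parallelogram => hn hm.
rewrite lerBlDr.
(* Doubling [hm] and [hn] produces four copies of the squared midpoint norm, which cancel and leave
   only the errors. *)
apply: le_trans (lerD (ler_wpM2l (ler0n _ 2) hm) (ler_wpM2l (ler0n _ 2) hn)) _.
by rewrite le_eqVlt; apply/orP; left; apply/eqP; ring.
Qed.

Lemma rkhs_cauchy_cvg (R : realType) (E : Type) (H : rkhs R E) (u : nat -> H) :
  (forall m n, `|u m - u n| ^+ 2 <= 2 * m.+1%:R^-1 + 2 * n.+1%:R^-1) ->
  exists l : H, u n @[n --> \oo] --> l.
Proof.
move=> hu; suff /cauchy_cvgP/cvg_ex[l ul] : cauchy (u n @[n --> \oo]) by exists l.
apply/cauchy_exP => e e0.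
(* For [n >= N] both terms of the bound are at most [2 / (N + 1)], hence the constant 4. *)
have [N _ hN] := @natSinv_small R 4 (e ^+ 2) (ler0n _ 4) (exprn_gt0 _ e0).
exists (u N); exists N => // n /= Nn; rewrite -ball_normE /=.
rewrite -(@ltr_pXn2r _ 2) ?nnegrE ?(ltW e0) //.
apply: le_lt_trans (hN _ (leqnn N)); apply: le_trans (hu N n) _.
have -> : 4 * N.+1%:R^-1 = 2 * N.+1%:R^-1 + 2 * N.+1%:R^-1 :> R[i].
  by rewrite -mulrDl -natrD.
rewrite lerD2l ler_wpM2l ?ler0n //.
by rewrite lef_pV2 ?posrE ?ltr0n // ler_nat.
Qed.

(** * Passing from one space to the other *)

Lemma rkhs_transfer (R : realType) (E : Type) (H1 H2 : rkhs R E) (K : E -> E -> R[i]) :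
  reproducing_kernel H1 K -> reproducing_kernel H2 K ->
  forall phi1 : H1, exists2 phi2 : H2, val phi2 = val phi1 & `|phi1| = `|phi2|.
Proof.
move=> /reproducing_kernel_family[k1 hk1] /reproducing_kernel_family[k2 hk2] phi1.
have [c hc] := minimizing_exists k1 phi1.
have cau := minimizing_cauchy _ _ hc.
have [l1 cl1] := rkhs_cauchy_cvg cau.
have [l2 cl2] : exists l : H2, kernel_comb k2 (c n) @[n --> \oo] --> l.
  apply: rkhs_cauchy_cvg => m n.
  (* A difference of combinations is again a combination, so its norm is the same in both spaces. *)
  suff -> : `|kernel_comb k2 (c m) - kernel_comb k2 (c n)| =
            `|kernel_comb k1 (c m) - kernel_comb k1 (c n)| by exact: cau.
  by rewrite !kernel_comb_sub (norm_kernel_comb _ hk2 hk1).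
have l1E : l1 = phi1.
  apply: val_inj; apply: funext => z.
  exact: complex_cvg_unique (rkhs_cvg_eval cl1) (minimizing_cvg hk1 hc).
exists l2.
  apply: funext => z; rewrite -l1E.
  apply: (complex_cvg_unique (rkhs_cvg_eval cl2)).
  (* The two sequences agree as functions, term by term. *)
  under eq_fun do rewrite (val_kernel_comb _ _ hk2) -(val_kernel_comb _ _ hk1).
  exact: rkhs_cvg_eval cl1.
rewrite -l1E; apply: (complex_cvg_unique (cvg_norm cl1)).
by under eq_fun do rewrite (norm_kernel_comb _ hk1 hk2); exact: cvg_norm cl2.
Qed.

Unset Implicit Arguments.

Theorem theorem2p26 (R : realType) (E : Type) (H1 H2 : rkhs R E)
    (K : E -> E -> R[i])
    (hK1 : reproducing_kernel H1 K) (hK2 : reproducing_kernel H2 K) :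
  rkhs_set H1 = rkhs_set H2 /\
  (forall (phi1 : H1) (phi2 : H2), val phi1 = val phi2 -> `|phi1| = `|phi2|).
Proof.
have sub (G1 G2 : rkhs R E) : reproducing_kernel G1 K -> reproducing_kernel G2 K ->
    rkhs_set G1 `<=` rkhs_set G2.
  move=> hG1 hG2 f /mem_set Sf.
  have [psi + _] := rkhs_transfer hG1 hG2 (Sub f Sf).
  by rewrite SubK => <-; exact/set_mem/(valP psi).
split; first by apply/seteqP; split; apply: sub.
(* The transferred [psi] has the same values as [phi2], so it is [phi2] by injectivity of [val]. *)
move=> phi1 phi2 e; have [psi psiE ->] := rkhs_transfer hK1 hK2 phi1.
by congr `|_|; apply: val_inj; rewrite psiE.
Qed.
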